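(* Let $n \geq 2$ and $k \geq 1$ be integers, and let $n=\prod_{j=1}^{\omega}\pi_j^{e_j}$ be the prime factorization of $n$, with $\pi_1,\dots,\pi_\omega$ distinct primes and all $e_j\geq 1$. Then $$F_k(n) = \sum_{\alpha \in \mathcal{P}_k} h(\beta) \prod_{j=1}^{\omega} \nu_\beta(e_j),$$ $$G_k(n) = \sum_{\alpha \in \mathcal{P}_k} h(\beta)\, (-1)^{\theta(\beta)} \prod_{j=1}^{\omega} \nu_\beta(e_j),$$ where $\beta=\beta(\alpha)=(\beta_1,\dots,\beta_a)$ and $$h(\beta) = \left(\prod_{i=1}^a i^{\beta_i}\, \beta_i! \right)^{-1}, \qquad \theta(\beta) = \sum_{i=1}^a (1+i)\beta_i .$$ Further, $\nu_\beta(1)=\beta_1$, and for every $m \geq 2$ the following recursion holds: $$\nu_\beta(m) = \frac{1}{m}\left(\gamma(m) + \sum_{k=1}^{m-1}\gamma(k)\,\nu_\beta(m-k)\right), \quad\text{where}\quad \gamma(m) = \sum_{d \mid m} d\,\beta_d .$$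
   Context: A factorization of $n$ is unordered: it is a finite multiset of positive integers (its parts) whose product is $n$. $F_k(n)$ denotes the number of factorizations of $n$ with exactly $k$ parts (counted with multiplicity), all parts being integers $\geq 1$. $G_k(n)$ denotes the number of factorizations of $n$ with exactly $k$ pairwise distinct parts, all parts being integers $\geq 1$. $\mathcal{P}_k$ is the set of all (unordered) partitions of $k$. For $\alpha\in\mathcal{P}_k$ with parts $\alpha_j$, put $a=\max_j \alpha_j$ and $\beta=\beta(\alpha)=(\beta_1,\dots,\beta_a)$ with $\beta_i=\#\{j: \alpha_j=i\}$, so that $\sum_{i=1}^a i\beta_i=k$. Set $\beta_d=0$ for $d>a$. For $m\geq 1$, $\nu_\beta(m)$ is the number of partitions of $m$ in which the part $i$ can appear in $\beta_i$ different colors (parts $i$ with $\beta_i=0$ do not occur; partitions are multisets of colored parts). Equivalently, $1+\sum_{m\geq1}\nu_\beta(m)x^m=\prod_{i=1}^a(1-x^i)^{-\beta_i}$. *)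

(* Defs.v *)
From mathcomp Require Import all_boot all_order all_algebra.
From mathcomp Require Import finmap multiset.
From mathcomp Require Import classical_sets cardinality fsbigop.

Set Implicit Arguments.
Unset Strict Implicit.
Unset Printing Implicit Defensive.

Import GRing.Theory.

Local Open Scope mset_scope.
Local Open Scope classical_set_scope.
Local Open Scope nat_scope.

(* A multiset [A : {mset T}] is used both as its multiplicity function [A x]
   and, via [enum_mset], as the sequence listing its elements with repetition;
   thus [size A] counts elements with multiplicity. *)

Definition factorizations (k n : nat) : set {mset nat} :=
  [set A | [/\ size A = k, {in A, forall x, 0 < x} & \prod_(x <- A) x = n]].

(* [fset_set] is the empty set on infinite sets; the sets counted below are
   shown to be finite at the end of this file. *)
Definition F (k n : nat) : nat := #|` fset_set (factorizations k n)|.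

Definition G (k n : nat) : nat :=
  #|` fset_set [set A | factorizations k n A /\ uniq A]|.

Definition int_partitions (k : nat) : set {mset nat} :=
  [set alpha | {in alpha, forall x, 0 < x} /\ \sum_(x <- alpha) x = k].

Definition max_part (alpha : {mset nat}) : nat := \max_(x <- alpha) x.

Definition beta (alpha : {mset nat}) (i : nat) : nat := alpha i.

(* The pair [(i, c)] is a part equal to [i] with color [c < b i]. *)
Definition colored_partitions (b : nat -> nat) (m : nat) :
    set {mset (nat * nat)} :=
  [set P | {in P, forall p, 0 < p.1 /\ p.2 < b p.1} /\ \sum_(p <- P) p.1 = m].

Definition nu (b : nat -> nat) (m : nat) : nat :=
  #|` fset_set (colored_partitions b m)|.

Definition h (a : nat) (b : nat -> nat) : rat :=
  ((\prod_(1 <= i < a.+1) (i ^ b i * (b i)`!))%N%:R^-1)%R.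

Definition theta (a : nat) (b : nat -> nat) : nat :=
  \sum_(1 <= i < a.+1) (1 + i) * b i.

Definition gamma (b : nat -> nat) (m : nat) : nat :=
  \sum_(d <- divisors m) d * b d.

Lemma finite_msets (T : choiceType) (s : seq T) (N : nat) :
  finite_set [set A : {mset T} | size A <= N /\ {subset A <= s}].
Proof.
apply: (@sub_finite_set _ _
  ((fun t : N.-bseq (seq_sub s) => seq_mset (map val t)) @` setT)).
  move=> A [sA As].
  have eqA : map val (pmap (insub : T -> option (seq_sub s)) A) = A.
    rewrite (pmap_filter (@insubK _ _ _)); apply/all_filterP/allP => x xA.
    by rewrite isSome_insub; exact: As.
  have szA : size (pmap (insub : T -> option (seq_sub s)) A) <= N.
    by rewrite -(size_map val) eqA.
  by exists (Bseq szA) => //=; rewrite eqA seq_mset_id.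
exact/finite_image/finite_finset.
Qed.

Lemma finite_factorizations (k n : nat) :
  0 < n -> finite_set (factorizations k n).
Proof.
move=> n0; apply: (sub_finite_set _ (finite_msets (iota 0 n.+1) k)).
move=> A [sA A0 An]; split; first by rewrite sA.
move=> x xA; rewrite mem_iota add0n ltnS -An.
apply: dvdn_leq; first by rewrite An.
by rewrite (big_rem x xA) /= dvdn_mulr.
Qed.

Lemma finite_colored_partitions (b : nat -> nat) (m : nat) :
  finite_set (colored_partitions b m).
Proof.
pose s := [seq (i, c) | i <- iota 0 m.+1, c <- iota 0 (b i)].
apply: (sub_finite_set _ (finite_msets s m)) => P [P0 Pm]; split.
  rewrite -Pm -sum1_size [leqLHS]big_seq [leqRHS]big_seq.
  by apply: leq_sum => p /P0[].
move=> [i c] pP; have [_ /= cb] := P0 _ pP.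
apply/allpairsPdep; exists i, c; split => //; last by rewrite mem_iota.
by rewrite mem_iota add0n ltnS -Pm (big_rem _ pP) /= leq_addr.
Qed.

Lemma finite_int_partitions (k : nat) : finite_set (int_partitions k).
Proof.
apply: (sub_finite_set _ (finite_msets (iota 0 k.+1) k)) => A [A0 Ak]; split.
  rewrite -Ak -sum1_size [leqLHS]big_seq [leqRHS]big_seq.
  by apply: leq_sum => p /A0.
move=> x xA.
by rewrite mem_iota add0n ltnS -Ak (big_rem _ xA) /= leq_addr.
Qed.

(* Main.v *)
Require Import Defs.
From mathcomp Require Import all_boot all_order all_algebra.
From mathcomp Require Import finmap multiset.
From mathcomp Require Import classical_sets cardinality fsbigop.
From mathcomp Require Import zify.

Set Implicit Arguments.
Unset Strict Implicit.
Unset Printing Implicit Defensive.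

(** Both identities are Newton's identities. With [t_d] a formal variable for
each possible part [d] and [n] recorded multiplicatively, [F_k] and [G_k] count
the monomials of the complete and elementary symmetric functions of degree [k],
and the sums over partitions are their expansions in power sums. Writing
[eps = 1] for [F] and [eps = -1] for [G], both sides [S_k(n)] satisfy

    k S_k(n) = sum_(1 <= i <= k) eps^(i+1) sum_(d^i | n) S_(k-i)(n / d^i),

which determines them by induction on [k].

On the counting side ([num_fact_rec]), [k] times the number of factorizations is
the sum over [d] of the total multiplicity of the part [d]. Removing one [d]
from the factorizations that contain it expresses the total multiplicity for
[(k, n)] by the number of factorizations and the total multiplicity for
[(k - 1, n / d)] ([total_mult_rec]), with the sign [eps] because a set of
distinct parts that receives a new [d] must avoid [d]; iterating gives the
powers [d^i].

On the side of partitions ([partition_sum_rec]), write [k] as the sum of the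
[i alpha(i)] and remove one part [i] from [alpha]. The weight [h] is made for
this: [i (B(i) + 1) h(B + i) = h(B)] ([cycle_weight_mset1D]). The product of the
[nu] counts the ways to give the parts of [alpha] positive integers [d_a] with
[n] the product of the [d_a ^ a]; summing over the integer [d] given to the
removed part yields the convolution over [d^i | n] ([prod_nu_conv]).

The recursion for [nu] ([nu_rec]) has the same origin: [m nu(m)] adds up the
sizes of all parts of all colored partitions of [m], and a colored part of size
[i] has total multiplicity equal to the sum of [nu(m - r i)] over [r >= 1]. *)

Import GRing.Theory.

Local Open Scope mset_scope.
Local Open Scope ring_scope.

(** * Removing an element from the members of a family of multisets *)

(** Named after links in simplicial complexes: the multisets obtained from the
members of [X] that contain [x] by removing one copy of [x]. *)
Definition link (T : choiceType) (x : T) (X : set {mset T}) : set {mset T} :=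
  [set B | X (x +` B)%mset]%classic.

Lemma mset1D_inj (T : choiceType) (x : T) :
  injective (fun B : {mset T} => (x +` B)%mset).
Proof. by move=> A B eqAB; rewrite -(msetD1K x A) eqAB msetD1K. Qed.

Lemma fsum_link (T : choiceType) (X : set {mset T}) (x : T)
    (V : nmodType) (f : {mset T} -> V) : finite_set X ->
  \sum_(A \in X) f A =
    \sum_(A \in (X `&` [set A | x \notin A])%classic) f A
      + \sum_(B \in link x X) f (x +` B)%mset.
Proof.
move=> Xfin; rewrite (fsbigID [set A : {mset T} | x \notin A]%classic) //=.
congr (_ + _); apply: reindex_fsbig; split=> [B XB|A B _ _|A [XA /= /negP]].
- by split=> //=; rewrite mset1D1.
- exact: mset1D_inj.
- rewrite negbK => xA; exists (A `\ x)%mset; last exact: msetB1K.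
  by rewrite /link /= msetB1K.
Qed.

(** Members of [X] that avoid [x] have weight [0], and adding [x] to [B]
raises its multiplicity to [(B x).+1]; no division by multiplicities occurs,
since [B] determines [x +` B]. *)
Lemma fsum_mult_link (T : choiceType) (X : set {mset T}) (x : T)
    (R : pzSemiRingType) (f : {mset T} -> R) : finite_set X ->
  \sum_(A \in X) (A x)%:R * f A =
    \sum_(B \in link x X) (B x).+1%:R * f (x +` B)%mset.
Proof.
move=> Xfin; rewrite (fsum_link x) // fsbig1 ?add0r => [|A [_ /=]].
  by apply: eq_fsbigr => B _; rewrite mset1DE eqxx.
by move=> /mset_eq0P ->; rewrite mul0r.
Qed.

Lemma fsum_mult_link1 (T : choiceType) (X : set {mset T}) (x : T) :
    finite_set X ->
  \sum_(A \in X) ((A x)%:R : rat) = \sum_(B \in link x X) ((B x).+1%:R : rat).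
Proof.
move=> Xfin.
transitivity (\sum_(A \in X) ((A x)%:R * 1 : rat)).
  by apply: eq_fsbigr => A _; rewrite mulr1.
by rewrite fsum_mult_link //; apply: eq_fsbigr => B _; rewrite mulr1.
Qed.

Lemma card_fsum (T : choiceType) (X : set T) : finite_set X ->
  (#|` fset_set X|)%:R = \sum_(x \in X) (1 : rat).
Proof. by move=> Xfin; rewrite fsbig_finite // -sum1_size natr_sum. Qed.

(** A sequence [r] that does not depend on [A] permits exchanging the sum over
[x] with a sum over a family of multisets [A]. *)
Lemma sum_mset_mult (T : choiceType) (A : {mset T}) (r : seq T) (w : T -> nat) :
  uniq r -> {subset A <= r} ->
  (\sum_(x <- A) w x = \sum_(x <- r) w x * A x)%N.
Proof.
move=> r_uniq Ar.
transitivity (\sum_(x <- A) \sum_(y <- r) w y * (x == y))%N.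
  apply: eq_big_seq => x /Ar xr; rewrite (bigD1_seq x) //= eqxx muln1.
  by rewrite big1 ?addn0 // => y; rewrite eq_sym => /negbTE ->; rewrite muln0.
rewrite exchange_big; apply: eq_bigr => y _.
rewrite -big_distrr /= -count_mem_mset -sum1_count [in RHS]big_mkcond /=.
by congr (_ * _)%N; apply: eq_bigr => x _; case: (x == y).
Qed.

Lemma big_mset1D (T : choiceType) (R : Type) (idx : R)
    (op : Monoid.com_law idx) (x : T) (B : {mset T}) (f : T -> R) :
  \big[op/idx]_(y <- (x +` B)%mset) f y = op (f x) (\big[op/idx]_(y <- B) f y).
Proof.
rewrite -[in LHS](seq_mset_id B) -mset_cons.
by rewrite (perm_big _ (perm_eq_seq_mset _)) big_cons.
Qed.

(** * The Newton recursion for the number of factorizations *)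

(** The flag [s] selects factorizations into distinct parts, so that both
counts are treated together, with the sign [(-1) ^+ s]. *)
Definition opt_distinct_factorizations (s : bool) (k n : nat) :
    set {mset nat} :=
  [set A | factorizations k n A /\ (s -> uniq A)]%classic.

Definition num_fact (s : bool) (k n : nat) : rat :=
  \sum_(A \in opt_distinct_factorizations s k n) (1 : rat).

Lemma finite_opt_distinct s k n : (0 < n)%N ->
  finite_set (opt_distinct_factorizations s k n).
Proof.
by move=> n0; apply: (sub_finite_set _ (finite_factorizations k n0)) => A [].
Qed.

Lemma uniq_msetP (T : choiceType) (A : {mset T}) :
  reflect (forall x, A x <= 1)%N (uniq A).
Proof.
apply: (iffP idP) => [/count_uniq_mem A1 x|A1].
  by rewrite -count_mem_mset A1 leq_b1.
apply: count_mem_uniq => x; rewrite count_mem_mset.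
by have := A1 x; have := mset_gt0 x A; case: (x \in A); case: (A x) => [|[]].
Qed.

Lemma uniq_mset1D (T : choiceType) (x : T) (B : {mset T}) :
  uniq (x +` B)%mset = (x \notin B) && uniq B.
Proof.
rewrite -[B in LHS]seq_mset_id -mset_cons.
by rewrite (perm_uniq (perm_eq_seq_mset _)).
Qed.

Lemma size_mset1D (T : choiceType) (x : T) (B : {mset T}) :
  size (x +` B)%mset = (size B).+1.
Proof. by rewrite -!sum1_size big_mset1D /= add1n. Qed.

Lemma link_factorizations (d k n : nat) : (0 < n)%N ->
  link d (factorizations k.+1 n) =
    (if (d %| n)%N then factorizations k (n %/ d)%N else set0)%classic.
Proof.
move=> n0; apply/seteqP; split=> [B|B].
  rewrite /link /factorizations /= size_mset1D big_mset1D /= => -[[sB] B0 Bn].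
  have d0 : (0 < d)%N by apply: B0; rewrite mset1D1.
  rewrite -Bn dvdn_mulr // mulKn //; split=> // x xB.
  by apply: B0; rewrite mset1Dr.
case: ifP => // dn [sB B0 Bn].
rewrite /link /factorizations /= size_mset1D big_mset1D /= sB Bn; split=> //.
  move=> x; rewrite in_mset1D => /orP[/eqP->|/B0//].
  exact: dvdn_gt0 dn.
by rewrite mulnC divnK.
Qed.

Definition total_mult (s : bool) (k n d : nat) : rat :=
  \sum_(A \in opt_distinct_factorizations s k n) ((A d)%:R : rat).

(** Removing one [d] turns the sum of the [A d] into the sum of [(B d).+1] over
the factorizations [B] of [n %/ d] to which [d] may be added. Without the
distinctness condition these are all [B], and [(B d).+1] is [1 + B d]. With it,
they are those with [B d = 0]; as [B d] is [0] or [1], their number is the sum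
of [1 - B d] over all [B]. *)
Lemma total_mult_rec s k n d : (0 < n)%N ->
  total_mult s k.+1 n d =
    if (d %| n)%N then
      num_fact s k (n %/ d) + (-1) ^+ s * total_mult s k (n %/ d) d
    else 0.
Proof.
move=> n0; rewrite /total_mult fsum_mult_link1; last exact: finite_opt_distinct.
have -> : link d (opt_distinct_factorizations s k.+1 n) =
    (link d (factorizations k.+1 n) `&`
       [set B | s -> (d \notin B) && uniq B])%classic.
  rewrite /link; apply/seteqP; split=> B [FB uB]; split=> //= sT;
    by move: (uB sT); rewrite uniq_mset1D.
rewrite link_factorizations //; case: ifP => dn; last first.
  by rewrite set0I fsbig_set0.
have q0 : (0 < n %/ d)%N.
  by rewrite divn_gt0 ?(dvdn_gt0 n0 dn) //; exact: dvdn_leq.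
rewrite /num_fact /total_mult mulr_fsumr -fsbig_split /=;
  last exact: finite_opt_distinct.
case: s; last first.
  transitivity (\sum_(B \in opt_distinct_factorizations false k (n %/ d)%N)
      ((B d).+1%:R : rat)).
    by apply: eq_fsbigl; apply/seteqP; split=> B [].
  by apply: eq_fsbigr => B _; rewrite mul1r nat1r.
transitivity (\sum_(B \in (factorizations k (n %/ d)%N `&`
    [set B | true -> (d \notin B) && uniq B])%classic)
    (1 + (-1) ^+ true * (B d)%:R : rat)).
  apply: eq_fsbigr => B; rewrite inE => -[_ /(_ isT)/andP[/mset_eq0P -> _]].
  by rewrite mulr0 addr0.
apply: fsbig_widen.
  by move=> B [FB /(_ isT)/andP[_ uB]].
move=> B [[FB uB] nB] /=.
have /uniq_msetP/(_ d) := uB isT; rewrite leq_eqVlt ltnS leqn0.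
case/orP=> [/eqP->|dB]; first by rewrite expr1 mulr1 subrr.
by case: nB; split=> // _; rewrite -mset_eq0 dB uB.
Qed.

(** The sign is written [i.+1] rather than [i.-1] to match the exponent
[theta]; the two have the same parity. *)
Lemma total_multE s k n d : (0 < n)%N ->
  total_mult s k n d =
    \sum_(1 <= i < k.+1 | (d ^ i %| n)%N)
      ((-1) ^+ s) ^+ i.+1 * num_fact s (k - i) (n %/ d ^ i).
Proof.
elim: k n => [|k IHk] n n0.
  rewrite big_geq // /total_mult fsbig1 // => A [[/eqP sA _ _] _].
  suff -> : A = mset0 by rewrite mset0E.
  by apply/msetP => x; rewrite mset0E -count_mem_mset; case: (enum_mset A) sA.
rewrite total_mult_rec // big_ltn_cond // expn1 big_add1 /=.
have [dn|ndn] := boolP (d %| n)%N; last first.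
  rewrite big1 // => i din; case/negP: ndn.
  by apply: dvdn_trans din; rewrite expnS dvdn_mulr.
have d0 := dvdn_gt0 n0 dn.
have q0 : (0 < n %/ d)%N by rewrite divn_gt0 //; exact: dvdn_leq.
rewrite sqrr_sign mul1r subn1 IHk // big_distrr /=; congr (_ + _).
apply: eq_big => i; first by rewrite expnS mulnC -dvdn_divRL.
by move=> _; rewrite mulrA -exprS subSS -divnMA -expnS.
Qed.

(** The factor [k] is the size of each factorization, that is the sum over [d]
of the multiplicities of [d]. *)
Lemma num_fact_rec s k n : (0 < n)%N ->
  k%:R * num_fact s k n =
    \sum_(1 <= i < k.+1) ((-1) ^+ s) ^+ i.+1 *
      \sum_(1 <= d < n.+1 | (d ^ i %| n)%N) num_fact s (k - i) (n %/ d ^ i).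
Proof.
move=> n0; transitivity (\sum_(1 <= d < n.+1) total_mult s k n d); last first.
  rewrite (eq_bigr _ (fun d _ => total_multE s k d n0)).
  rewrite (exchange_big_dep_nat predT) //=; apply: eq_bigr => i _.
  by rewrite big_distrr.
rewrite /total_mult.
have Xfin := finite_opt_distinct s k n0.
rewrite /num_fact mulr_fsumr !fsbig_finite //=.
rewrite (eq_bigr _ (fun d _ => fsbig_finite _ _ Xfin)) exchange_big /=.
rewrite !big_seq; apply: eq_bigr => A.
rewrite in_fset_set // inE mulr1 => -[[sA A0 An] _].
rewrite -sA -sum1_size (sum_mset_mult (r := index_iota 1 n.+1)) ?iota_uniq //.
  by rewrite natr_sum; apply: eq_bigr => d _; rewrite mul1n.
move=> x xA; rewrite mem_index_iota A0 //= ltnS -An.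
by apply: dvdn_leq; rewrite ?An // -An (big_rem x xA) /= dvdn_mulr.
Qed.

(** * Colored partitions *)

Lemma nuE b m : (nu b m)%:R = \sum_(P \in colored_partitions b m) (1 : rat).
Proof. exact/card_fsum/finite_colored_partitions. Qed.

Lemma link_colored_partitions b i c m : (0 < i)%N -> (c < b i)%N ->
  link (i, c) (colored_partitions b m) =
    (if (i <= m)%N then colored_partitions b (m - i)%N else set0)%classic.
Proof.
move=> i0 cb; apply/seteqP; split=> [B|B].
  rewrite /link /colored_partitions /= big_mset1D /= => -[B0 <-].
  by rewrite leq_addr addKn; split=> // x xB; apply: B0; rewrite mset1Dr.
case: ifP => // im [B0 Bm].
rewrite /link /colored_partitions /= big_mset1D /= Bm subnKC //; split=> // x.
by rewrite in_mset1D => /orP[/eqP->|/B0//].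
Qed.

Lemma nu0 b : nu b 0 = 1%N.
Proof.
suff -> : (nu b 0 = #|` fset_set [set mset0 : {mset (nat * nat)}]%classic|)%N.
  by rewrite fset_set1 cardfs1.
congr (#|` fset_set _|); apply/seteqP; split=> [P [P0 Pm]|_ ->]; last first.
  by split; rewrite ?big_mset0 // => p; rewrite in_mset0.
apply/msetP => p; rewrite mset0E; apply/eqP; rewrite mset_eq0.
apply/negP => pP; have [p0 _] := P0 _ pP.
by move: Pm; rewrite (big_rem _ pP) /=; case: p.1 p0.
Qed.

(** If [b'] has one color more than [b] for the part [i], the new colored part
is [(i, b i)]: a partition either avoids it, or arises by adding one copy of it
to a partition of [m - i]. *)
Lemma nu_add_color b b' i m : (0 < i)%N ->
    (forall x, b' x = (x == i) + b x)%N ->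
  (nu b' m = nu b m + if i <= m then nu b' (m - i) else 0)%N.
Proof.
move=> i0 b'E; apply/eqP; rewrite -(Num.Theory.eqr_nat rat); apply/eqP.
have fin := finite_colored_partitions.
rewrite natrD nuE (fsum_link (i, b i)) //.
rewrite link_colored_partitions // ?b'E ?eqxx //.
congr (_ + _); last by case: ifP; rewrite ?fsbig_set0 ?nuE.
rewrite nuE; apply: eq_fsbigl; apply/seteqP; split=> [P [[P0 Pm] /= ibP]|].
  split=> // -[j c] jcP; have := P0 _ jcP; rewrite /= b'E => -[j0 cb].
  split=> //; move: cb; case: (j =P i) => // ji.
  rewrite add1n ltnS leq_eqVlt => /orP[/eqP cb|//].
  by case/negP: ibP; rewrite -ji -cb.
move=> P [P0 Pm]; split=> /=.
  split=> // p /P0[p0 pb]; split=> //.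
  by rewrite b'E; apply: leq_trans pb (leq_addl _ _).
by apply/negP => /P0[_ /=]; rewrite ltnn.
Qed.

(** The index [c] is the number of copies of the new colored part; the bound
[M] is arbitrary so that different values of [m] can share it. *)
Lemma nu_add_color_sum b b' i m M : (0 < i)%N ->
    (forall x, b' x = (x == i) + b x)%N -> (m < M)%N ->
  (nu b' m = \sum_(0 <= c < M | i * c <= m) nu b (m - i * c))%N.
Proof.
move=> i0 b'E; elim: M m => // M IHM m mM.
rewrite big_ltn_cond // muln0 leq0n subn0 big_add1 /= (nu_add_color _ i0 b'E).
congr (_ + _)%N; case: leqP => im.
  rewrite IHM; last by lia.
  by apply: eq_big => c; rewrite mulnS -?subnDA; lia.
by rewrite big1 // => c; rewrite mulnS; lia.
Qed.

Definition nu_mult b m p : rat :=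
  \sum_(P \in colored_partitions b m) ((P p)%:R : rat).

(** Indexing by the total [l] taken up by copies of [(i, c)], instead of by
their number, prepares the appearance of the divisors of [l] in [gamma]. *)
Lemma nu_multE b m i c : (0 < i)%N -> (c < b i)%N ->
  nu_mult b m (i, c) =
    \sum_(1 <= l < m.+1 | (i %| l)%N) (nu b (m - l))%:R.
Proof.
move=> i0 cb; elim/ltn_ind: m => m IHm.
rewrite /nu_mult fsum_mult_link1; last exact: finite_colored_partitions.
rewrite link_colored_partitions //; case: leqP => im; last first.
  rewrite fsbig_set0 big_nat_cond big1 // => l /andP[/andP[l0 lm] il].
  by have := dvdn_leq l0 il; lia.
transitivity ((nu b (m - i))%:R + nu_mult b (m - i) (i, c)).
  rewrite nuE -fsbig_split /=; last exact: finite_colored_partitions.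
  by apply: eq_fsbigr => B _; rewrite nat1r.
rewrite IHm; last by lia.
rewrite [RHS](big_cat_nat (n := i)) //=; last by lia.
rewrite [X in _ = X + _]big_nat_cond [X in _ = X + _]big1 ?add0r; last first.
  by move=> l /andP[/andP[l0 li] il]; have := dvdn_leq l0 il; lia.
rewrite [RHS]big_ltn_cond ?dvdnn; last by lia.
congr (_ + _); rewrite -[i.+1]add1n [RHS]big_addn subSn //.
by apply: eq_big => l; rewrite ?dvdn_addl // addnC subnDA.
Qed.

(** Each partition [P] of [m] contributes [m], the sum over the colored parts
[(i, c)] of [i] times the multiplicity. For fixed [l], the pairs [(i, c)] with
[i] dividing [l] contribute [gamma b l], since each [i] has [b i] colors. *)
Lemma nu_rec b m :
  m%:R * (nu b m)%:R =
    \sum_(1 <= l < m.+1) (gamma b l)%:R * (nu b (m - l))%:R :> rat.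
Proof.
have fin := finite_colored_partitions b m.
pose r := [seq (i, c) | i <- index_iota 1 m.+1, c <- index_iota 0 (b i)].
have r_uniq : uniq r.
  apply: allpairs_uniq_dep => [|i _|]; rewrite ?iota_uniq //.
  by move=> [i c] [j d] _ _ /= [-> ->].
transitivity (\sum_(p <- r) p.1%:R * nu_mult b m p).
  rewrite /nu_mult nuE mulr_fsumr.
  under [RHS]eq_bigr do rewrite fsbig_finite // big_distrr /=.
  rewrite exchange_big fsbig_finite //= !big_seq; apply: eq_bigr => P.
  rewrite in_fset_set // inE mulr1 => -[P0 Pm].
  rewrite -Pm (sum_mset_mult _ r_uniq).
    by rewrite natr_sum; apply: eq_bigr => p _; rewrite natrM.
  move=> [i c] pP; have [/= i0 cb] := P0 _ pP.
  apply/allpairsPdep; exists i, c; split=> //; rewrite mem_index_iota //.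
  by rewrite i0 ltnS -Pm (big_rem _ pP) leq_addr.
rewrite big_allpairs_dep /=.
transitivity (\sum_(1 <= i < m.+1) \sum_(1 <= l < m.+1 | (i %| l)%N)
    (i * b i)%:R * (nu b (m - l))%:R : rat).
  apply: eq_big_seq => i; rewrite mem_index_iota => /andP[i0 _].
  rewrite -!big_distrr /= big_nat_cond.
  under eq_bigr => c /andP[/andP[_ cb] _] do rewrite nu_multE //.
  rewrite -big_nat_cond sumr_const_nat subn0 natrM.
  by rewrite -[X in _ * X]mulr_natr mulrA mulrAC.
rewrite (exchange_big_dep_nat predT) //=; apply: eq_big_nat => l /andP[l0 lm].
rewrite -big_distrl /= -natr_sum; congr (_%:R * _).
rewrite /gamma -big_filter; apply/perm_big/uniq_perm.
- by rewrite filter_uniq ?iota_uniq.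
- exact: divisors_uniq.
move=> d; rewrite mem_filter mem_index_iota -dvdn_divisors //.
case dl: (d %| l)%N => //=; rewrite (dvdn_gt0 l0 dl) /=.
exact: leq_ltn_trans (dvdn_leq l0 dl) lm.
Qed.

(** * Products over the primes of an integer *)

Definition prod_nu w (p : 'I_w -> nat) (b : nat -> nat) (n : nat) : rat :=
  \prod_(j < w) (nu b (logn (p j) n))%:R.

Definition smooth w (p : 'I_w -> nat) (n : nat) : Prop :=
  n = (\prod_(j < w) p j ^ logn (p j) n)%N.

Lemma prime_prod_gt0 w (p c : 'I_w -> nat) : (forall j, prime (p j)) ->
  (0 < \prod_(j < w) p j ^ c j)%N.
Proof.
by move=> p_prime; rewrite prodn_gt0 // => j; rewrite expn_gt0 prime_gt0.
Qed.

(** For a prime [q] outside the range of [p] the sum is empty: this covers at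
once the exponents of the given primes and the absence of others. *)
Lemma logn_prime_prod w (p c : 'I_w -> nat) q : (forall j, prime (p j)) ->
  prime q ->
  logn q (\prod_(j < w) p j ^ c j) = (\sum_(j < w | p j == q) c j)%N.
Proof.
move=> p_prime q_prime; rewrite [RHS]big_mkcond /=.
(* Positivity has to be carried along, since [lognM] requires it. *)
pose K (x y : nat) : Prop := (0 < x)%N && (logn q x == y).
have: K (\prod_(j < w) p j ^ c j)%N
    (\sum_(j < w) if p j == q then c j else 0)%N.
  apply: (big_ind2 K) => [|x x' y y'|j _]; rewrite /K.
  - by rewrite logn1.
  - case/andP=> x0 /eqP <- /andP[y0 /eqP <-].
    by rewrite muln_gt0 x0 y0 lognM ?eqxx.
  - rewrite expn_gt0 prime_gt0 //= lognX logn_prime // [q == _]eq_sym.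
    by case: (p j == q); rewrite ?muln1 ?muln0 eqxx.
by case/andP=> _ /eqP.
Qed.

Lemma logn_prime_prod_inj w (p c : 'I_w -> nat) i : injective p ->
  (forall j, prime (p j)) -> logn (p i) (\prod_(j < w) p j ^ c j) = c i.
Proof.
move=> p_inj p_prime; rewrite logn_prime_prod //.
by rewrite (big_pred1 i) // => j; rewrite (inj_eq p_inj).
Qed.

Lemma smooth_prime_prod w (p c : 'I_w -> nat) : injective p ->
  (forall j, prime (p j)) -> smooth p (\prod_(j < w) p j ^ c j).
Proof.
move=> p_inj p_prime; rewrite /smooth; apply: eq_bigr => j _.
by rewrite logn_prime_prod_inj.
Qed.

Lemma smooth_gt0 w (p : 'I_w -> nat) n : (forall j, prime (p j)) ->
  smooth p n -> (0 < n)%N.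
Proof. by move=> p_prime ->; exact: prime_prod_gt0. Qed.

Lemma smooth_dvdn w (p : 'I_w -> nat) n d : injective p ->
  (forall j, prime (p j)) -> smooth p n -> (d %| n)%N -> smooth p d.
Proof.
move=> p_inj p_prime sn dn; have n0 := smooth_gt0 p_prime sn.
have d0 := dvdn_gt0 n0 dn.
apply: eqn_from_log => // [|q]; first exact: prime_prod_gt0.
have [q_prime|/negbTE qnp] := boolP (prime q);
  last by rewrite lognE [RHS]lognE qnp.
have [/existsP[j /eqP <-]|/existsPn q_nin] := boolP [exists j, p j == q].
  by rewrite logn_prime_prod_inj.
rewrite logn_prime_prod // big1 => [|j pjq];
  last by have := q_nin j; rewrite pjq.
apply/eqP; rewrite -leqn0; apply: leq_trans (dvdn_leq_log q n0 dn) _.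
rewrite {}sn logn_prime_prod // big1 // => j pjq.
by have := q_nin j; rewrite pjq.
Qed.

(** A divisor [d] with [d ^ i] dividing [n] is the same as a vector [c] of
exponents with [i * c j <= logn (p j) n] for all [j]; expanding the product over
[j] of the sums over [c j] given by [nu_add_color_sum] therefore yields the sum
over [d]. *)
Lemma prod_nu_conv w (p : 'I_w -> nat) b b' i n : injective p ->
    (forall j, prime (p j)) -> smooth p n -> (0 < i)%N ->
    (forall x, b' x = (x == i) + b x)%N ->
  prod_nu p b' n =
    \sum_(1 <= d < n.+1 | (d ^ i %| n)%N) prod_nu p b (n %/ d ^ i).
Proof.
move=> p_inj p_prime sn i0 b'E; have n0 := smooth_gt0 p_prime sn.
have ltn_log q m : (0 < m <= n)%N -> (logn q m < n.+1)%N.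
  by case/andP=> m0 mn; rewrite ltnS (leq_trans _ mn) // ltnW // ltn_logl.
(* [inord] sends a product exceeding [n] to [0], which [P] excludes; so all
   exponent vectors may be allowed, with the bad ones contributing [0]. *)
pose dvec (f : {ffun 'I_w -> 'I_n.+1}) : 'I_n.+1 :=
  inord (\prod_(j < w) p j ^ f j).
pose vecd (d : 'I_n.+1) : {ffun 'I_w -> 'I_n.+1} :=
  [ffun j => inord (logn (p j) d)].
pose P (d : 'I_n.+1) := ((0 < d) && (d ^ i %| n))%N.
have P_smooth d : P d -> smooth p d.
  case/andP=> d0 din; apply: smooth_dvdn sn _ => //.
  by apply: dvdn_trans din; rewrite -{1}(expn1 d) dvdn_exp2l.
have vecdE d j : P d -> vecd d j = logn (p j) d :> nat.
  by case/andP=> d0 _; rewrite ffunE inordK // ltn_log // d0 -ltnS ltn_ord.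
have -> : \sum_(1 <= d < n.+1 | (d ^ i %| n)%N) prod_nu p b (n %/ d ^ i) =
    \sum_(d : 'I_n.+1 | P d) prod_nu p b (n %/ d ^ i).
  rewrite -(big_mkord (fun d => (0 < d) && (d ^ i %| n))%N
    (fun d => prod_nu p b (n %/ d ^ i))) [RHS]big_ltn_cond //=.
  rewrite [LHS]big_nat_cond [RHS]big_nat_cond; apply: eq_bigl => d.
  by case: d.
rewrite (reindex_onto dvec vecd) => [|d Pd]; last first.
  apply: val_inj; rewrite /dvec /= (eq_bigr (fun j => p j ^ logn (p j) d))%N.
    by rewrite -(P_smooth d Pd) inordK.
  by move=> j _; rewrite vecdE.
rewrite /prod_nu.
transitivity (\prod_(j < w) \sum_(c < n.+1)
    if (i * c <= logn (p j) n)%N then (nu b (logn (p j) n - i * c))%:R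
    else 0 : rat).
  apply: eq_bigr => j _.
  rewrite (nu_add_color_sum (M := n.+1) i0 b'E) ?ltn_log ?n0 //=.
  by rewrite big_mkord natr_sum big_mkcond.
rewrite bigA_distr_bigA [RHS]big_mkcond /=; apply: eq_bigr => f _.
case: ifP => [/andP[Pf /eqP ff]|Pf].
  apply: eq_bigr => j _; have [f0 fn] := andP Pf.
  have fj : f j = logn (p j) (dvec f) :> nat by rewrite -vecdE // ff.
  by rewrite fj logn_div // lognX ifT // -lognX dvdn_leq_log.
have [/forallP le_f|/forallPn[j /negbTE lt_f]] :=
    boolP [forall j, i * f j <= logn (p j) n]%N; last first.
  by rewrite (bigD1 j) //= lt_f mul0r.
have dn : ((\prod_(j < w) p j ^ f j) ^ i %| n)%N.
  rewrite [X in (_ %| X)%N]sn.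
  rewrite (big_morph (expn^~ i) (fun x y => expnMn x y i) (exp1n i)).
  elim/big_ind2: _ => // [x x' y y'|j _].
    exact: dvdn_mul.
  by rewrite -expnM dvdn_exp2l // mulnC.
have fn : (\prod_(j < w) p j ^ f j < n.+1)%N.
  rewrite ltnS; apply: dvdn_leq => //; apply: dvdn_trans dn.
  by rewrite -{1}(expn1 (\prod_(j < w) _)%N) dvdn_exp2l.
have dvecE : dvec f = (\prod_(j < w) p j ^ f j)%N :> nat by rewrite inordK.
have Pdf : P (dvec f) by rewrite /P dvecE prime_prod_gt0.
case/negP: Pf; rewrite Pdf; apply/eqP/ffunP => j; apply: val_inj.
by rewrite /= vecdE // dvecE logn_prime_prod_inj.
Qed.

(** * The Newton recursion for the sum over partitions *)

(** With a partition [alpha] of [k] viewed as a cycle type, [h] is the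
proportion of permutations of [k] points that have this type, and the parity of
[theta] is their signature. *)
Definition cycle_weight (s : bool) (alpha : {mset nat}) : rat :=
  h (max_part alpha) (beta alpha)
  * ((-1) ^+ s) ^+ theta (max_part alpha) (beta alpha).

Definition cycle_factor (s : bool) (i c : nat) : rat :=
  ((-1) ^+ s) ^+ ((1 + i) * c) / (i ^ c * c`!)%:R.

Lemma leq_max_part (alpha : {mset nat}) i : alpha i != 0%N ->
  (i <= max_part alpha)%N.
Proof.
by rewrite mset_neq0 => ia; rewrite /max_part (big_rem i) //= leq_maxl.
Qed.

(** Sizes of parts above the maximum contribute the factor [1], so that
partitions with different maxima can be compared over a common range. *)
Lemma cycle_weightE s (alpha : {mset nat}) M : (max_part alpha <= M)%N ->
  cycle_weight s alpha = \prod_(1 <= i < M.+1) cycle_factor s i (alpha i).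
Proof.
move=> aM; rewrite (big_cat_nat (n := (max_part alpha).+1)) //=.
rewrite [X in _ * X]big_nat_cond [X in _ * X]big1 ?mulr1; last first.
  move=> i /andP[/andP[ai _] _]; have /eqP -> : alpha i == 0%N.
    by apply/negPn/negP => /leq_max_part; rewrite leqNgt ai.
  by rewrite /cycle_factor muln0 expr0 expn0 fact0 invr1 mulr1.
rewrite /cycle_weight /h /theta [RHS]big_split /= mulrC natr_prod.
congr (_ * _).
  exact: (big_morph _ (exprD _) (expr0 _)).
by rewrite prodfV.
Qed.

Lemma cycle_factorS s i c : (0 < i)%N ->
  (i * c.+1)%:R * cycle_factor s i c.+1 =
    ((-1) ^+ s) ^+ i.+1 * cycle_factor s i c.
Proof.
move=> i0; rewrite /cycle_factor [((1 + i) * c.+1)%N]mulnS exprD add1n.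
have -> : (i ^ c.+1 * c.+1`! = (i * c.+1) * (i ^ c * c`!))%N.
  by rewrite expnS factS mulnACA.
have nz : ((i * c.+1)%:R != 0 :> rat).
  by rewrite Num.Theory.pnatr_eq0 -lt0n muln_gt0 i0.
move: (i * c.+1)%N nz => a nz.
by rewrite natrM invfM mulrCA -!mulrA mulVKf.
Qed.

Lemma cycle_weight_mset1D s i (B : {mset nat}) : (0 < i)%N ->
  (i * (B i).+1)%:R * cycle_weight s (i +` B) =
    ((-1) ^+ s) ^+ i.+1 * cycle_weight s B.
Proof.
move=> i0; have maxE : max_part (i +` B) = maxn i (max_part B).
  by rewrite /max_part big_mset1D.
rewrite (@cycle_weightE _ (i +` B) _ (leqnn _)).
rewrite (@cycle_weightE _ B (max_part (i +` B))); last first.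
  by rewrite maxE leq_maxr.
have ir : i \in index_iota 1 (max_part (i +` B)).+1.
  by rewrite mem_index_iota i0 ltnS maxE leq_maxl.
rewrite !(bigD1_seq i) ?iota_uniq //= [LHS]mulrA [RHS]mulrA.
congr (_ * _); last first.
  by apply: eq_bigr => j /negbTE ji; rewrite mset1DE ji.
have -> : (i +` B) i = (B i).+1 by rewrite mset1DE eqxx.
exact: cycle_factorS.
Qed.

Definition partition_sum w (p : 'I_w -> nat) s k n : rat :=
  \sum_(alpha \in int_partitions k)
    cycle_weight s alpha * prod_nu p (beta alpha) n.

Lemma link_int_partitions i k : (0 < i)%N -> (i <= k)%N ->
  link i (int_partitions k) = int_partitions (k - i).
Proof.
move=> i0 ik; apply/seteqP; split=> B.
  rewrite /link /int_partitions /= big_mset1D /= => -[B0 <-].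
  by rewrite addKn; split=> // x xB; apply: B0; rewrite mset1Dr.
move=> [B0 Bk]; rewrite /link /int_partitions /= big_mset1D /= Bk subnKC //.
by split=> // x; rewrite in_mset1D => /orP[/eqP->|/B0].
Qed.

(** The factor [k] is the sum of the [i * alpha i]; removing one part [i]
replaces [i * alpha i] times the weight of [alpha] by the weight of the
remaining partition, and [prod_nu_conv] accounts for the integer [d] attached to
the removed part. *)
Lemma partition_sum_rec w (p : 'I_w -> nat) s k n : injective p ->
    (forall j, prime (p j)) -> smooth p n ->
  k%:R * partition_sum p s k n =
    \sum_(1 <= i < k.+1) ((-1) ^+ s) ^+ i.+1 *
      \sum_(1 <= d < n.+1 | (d ^ i %| n)%N)
        partition_sum p s (k - i) (n %/ d ^ i).
Proof.
move=> p_inj p_prime sn; have fin := finite_int_partitions k.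
pose f alpha := cycle_weight s alpha * prod_nu p (beta alpha) n.
transitivity (\sum_(1 <= i < k.+1) \sum_(alpha \in int_partitions k)
    i%:R * ((alpha i)%:R * f alpha)).
  under [RHS]eq_bigr do rewrite fsbig_finite //.
  rewrite mulr_fsumr fsbig_finite // exchange_big /= !big_seq.
  apply: eq_bigr => alpha; rewrite in_fset_set // inE => -[a0 ak].
  under eq_bigr do rewrite mulrA; rewrite -big_distrl /= -/(f _); congr (_ * _).
  transitivity ((\sum_(x <- (alpha : {mset nat})) x)%:R : rat);
    first by rewrite ak.
  rewrite (sum_mset_mult (r := index_iota 1 k.+1)) ?iota_uniq //.
    by rewrite natr_sum; apply: eq_bigr => i _; rewrite natrM.
  move=> x xa; rewrite mem_index_iota a0 //= ltnS -ak (big_rem x xa).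
  exact: leq_addr.
apply: eq_big_nat => i /andP[i0 ik].
rewrite -mulr_fsumr fsum_mult_link // link_int_partitions //.
have finB := finite_int_partitions (k - i).
rewrite /partition_sum; under [in RHS]eq_bigr do rewrite fsbig_finite //.
rewrite exchange_big /= !mulr_fsumr fsbig_finite // big_distrr.
apply: eq_bigr => B _; rewrite /= -big_distrr /=.
rewrite -(prod_nu_conv p_inj p_prime sn i0 (b' := beta (i +` B))); last first.
  by move=> x; rewrite /beta mset1DE.
by rewrite [RHS]mulrA -cycle_weight_mset1D // /f natrM -!mulrA.
Qed.

Lemma nu_mset0 m : nu (beta mset0) m = (m == 0%N).
Proof.
case: m => [|m]; first exact: nu0.
apply/eqP; rewrite -(Num.Theory.eqr_nat rat) /=.
have := nu_rec (beta mset0) m.+1; rewrite big1 => [/eqP|l _].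
  by rewrite mulf_eq0 Num.Theory.pnatr_eq0.
by rewrite /gamma big1 ?mul0r // => d _; rewrite /beta mset0E muln0.
Qed.

(** The recursion passes from [n] to the divisors [n %/ d ^ i], so the statement
proved by induction has to cover exponents that are [0], hence [smooth]. At
[k = 0] both sides count the empty factorization, which is one of [n = 1]. *)
Lemma num_fact_partition_sum w (p : 'I_w -> nat) s k n : injective p ->
    (forall j, prime (p j)) -> smooth p n ->
  num_fact s k n = partition_sum p s k n.
Proof.
move=> p_inj p_prime; elim/ltn_ind: k n => -[_|k IHk] n sn.
  have -> : num_fact s 0 n = (n == 1%N)%:R.
    rewrite /num_fact; have [->|n1] := eqVneq n 1%N.
      transitivity (\sum_(A \in [set (mset0 : {mset nat})]%classic) (1 : rat));
        last by rewrite fsbig_set1.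
      apply: eq_fsbigl; apply/seteqP; split=> [A [[/eqP sA _ _] _]|A ->] /=.
        apply/msetP => x; rewrite mset0E -count_mem_mset.
        by case: (enum_mset A) sA.
      by split; rewrite ?enum_mset0 //; split; rewrite ?enum_mset0 // big_nil.
    rewrite fsbig1 // => A [[/eqP sA _ An] _]; case/negP: n1; rewrite -An.
    by case: (enum_mset A) sA => //; rewrite big_nil.
  rewrite /partition_sum.
  have -> : int_partitions 0 = [set (mset0 : {mset nat})]%classic.
    apply/seteqP; split=> [A [A0 As]|A ->]; last first.
      by split; rewrite ?big_mset0 // => x; rewrite in_mset0.
    apply/msetP => x; rewrite mset0E; apply/eqP; rewrite mset_eq0.
    apply/negP => xA; have := A0 x xA.
    by move: As; rewrite (big_rem x xA) /=; case: x {xA}.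
  rewrite fsbig_set1 (@cycle_weightE _ mset0 0) ?big_geq ?mul1r //; last first.
    by rewrite /max_part big_mset0.
  have [->|n1] := eqVneq n 1%N.
    by rewrite /prod_nu big1 // => j _; rewrite logn1 nu_mset0.
  have [/forallP e0|/forallPn[j ej]] := boolP [forall j, logn (p j) n == 0%N].
    by case/eqP: n1; rewrite sn big1 // => j _; rewrite (eqP (e0 j)).
  by rewrite /prod_nu (bigD1 j) //= nu_mset0 (negbTE ej) mul0r.
have n0 := smooth_gt0 p_prime sn.
apply: (mulfI (x := k.+1%:R)); first by rewrite Num.Theory.pnatr_eq0.
rewrite num_fact_rec // partition_sum_rec //.
apply: eq_big_nat => i /andP[i0 ik].
congr (_ * _); apply: eq_bigr => d din; apply: IHk; first by lia.
apply: smooth_dvdn sn _ => //; exact: dvdn_div.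
Qed.

(** * The formulas and the recursion *)

Theorem theorem1 (n k w : nat) (p e : 'I_w -> nat)
    (n_ge2 : (2 <= n)%N) (k_ge1 : (1 <= k)%N)
    (p_inj : injective p)
    (p_prime : forall j, prime (p j))
    (e_ge1 : forall j, (1 <= e j)%N)
    (n_fact : n = (\prod_(j < w) p j ^ e j)%N) :
  [/\ (F k n)%:R =
        \sum_(alpha \in int_partitions k)
          h (max_part alpha) (beta alpha)
          * \prod_(j < w) (nu (beta alpha) (e j))%:R :> rat,
      (G k n)%:R =
        \sum_(alpha \in int_partitions k)
          h (max_part alpha) (beta alpha)
          * (-1) ^+ theta (max_part alpha) (beta alpha)
          * \prod_(j < w) (nu (beta alpha) (e j))%:R :> rat
    & forall alpha, int_partitions k alpha ->
        nu (beta alpha) 1 = beta alpha 1 /\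
        forall m : nat, (2 <= m)%N ->
          (nu (beta alpha) m)%:R =
            m%:R^-1 * ((gamma (beta alpha) m)%:R
              + \sum_(1 <= l < m)
                  (gamma (beta alpha) l)%:R * (nu (beta alpha) (m - l))%:R)
            :> rat].
Proof.
have sn : smooth p n by rewrite n_fact; exact: smooth_prime_prod.
have n0 := smooth_gt0 p_prime sn.
have nuE_n b : \prod_(j < w) (nu b (e j))%:R = prod_nu p b n.
  by apply: eq_bigr => j _; rewrite n_fact logn_prime_prod_inj.
split.
- rewrite card_fsum; last exact: finite_factorizations.
  transitivity (num_fact false k n).
    by apply: eq_fsbigl; apply/seteqP; split=> A // [].
  rewrite (num_fact_partition_sum _ _ p_inj p_prime sn).
  apply: eq_fsbigr => alpha _.
  by rewrite /cycle_weight expr0 expr1n mulr1 nuE_n.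
- rewrite card_fsum; last first.
    by apply: (sub_finite_set _ (finite_factorizations k n0)) => A [].
  transitivity (num_fact true k n).
    by apply: eq_fsbigl; apply/seteqP; split=> A [FA uA]; split=> //; exact: uA.
  rewrite (num_fact_partition_sum _ _ p_inj p_prime sn).
  by apply: eq_fsbigr => alpha _; rewrite /cycle_weight expr1 nuE_n.
move=> alpha _; split=> [|m m2].
  apply/eqP; rewrite -(Num.Theory.eqr_nat rat) -[X in X == _]mul1r.
  by rewrite (nu_rec _ 1) big_nat1 nu0 mulr1 /gamma big_seq1 mul1n.
have m0 : (m%:R != 0 :> rat) by rewrite Num.Theory.pnatr_eq0; lia.
apply: (mulfI m0); rewrite mulrA mulfV // mul1r nu_rec.
rewrite big_nat_recr /=; last by lia.
by rewrite subnn nu0 mulr1 addrC.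
Qed.
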